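(* Let $I\ne\{0\}$ be a graded ideal in $A=\mathbb C[z_1,\dots,z_d]$ and let $M=\bar I$ be its closure in $H^2(\mathbb C^d)$, with canonical operators $T_kf=z_kf$ ($f\in M$) and defect operator $\Delta=(\mathbf 1_M-T_1T_1^*-\dots-T_dT_d^* )^{1/2}$. Let $G=\overline{\Delta M}$, and for $n=0,1,2,\dots$ let $G_n$ be the space of homogeneous polynomials of degree $n$ in $G$ (a subspace invariant under $\Delta$), and let $\Psi_n$ be an orthonormal basis for $G_n$ consisting of eigenvectors of $\Delta$. Then the set $$\Phi=\Phi_0\cup\Phi_1\cup\Phi_2\cup\cdots,\qquad \Phi_n=\Delta\Psi_n=\{\Delta\psi:\psi\in\Psi_n\},$$ is a metric basis for $I$.
   Context: Let $d\ge1$, $A=\mathbb C[z_1,\dots,z_d]$. $H^2(\mathbb C^d)$ is the Hilbert space completion of $A$ in the inner product for which monomials are mutually orthogonal and $\|z^\alpha\|^2=\alpha!/|\alpha|!$ (the symmetric Fock space); $\|\cdot\|$ denotes its norm. An ideal is graded if it is spanned by its homogeneous polynomials. A generator of a graded ideal $I$ is a (finite or infinite) linearly independent set $\Phi$ of homogeneous polynomials in $I$ such that every $g\in I$ is a finite sum $g=f_1\phi_1+\dots+f_r\phi_r$ with $f_k\in A$, $\phi_k\in\Phi$. It is contractive if $\|f_1\phi_1+\dots+f_r\phi_r\|^2\le\|f_1\|^2+\dots+\|f_r\|^2$ for all distinct $\phi_1,\dots,\phi_r\in\Phi$ and all $f_1,\dots,f_r\in A$. A metric basis for a nonzero graded ideal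 $I$ is a contractive generator $\Phi$ such that every polynomial $g\in I$ of degree $n$ has a representation $g=f_1\phi_1+\dots+f_r\phi_r$ with $\phi_1,\dots,\phi_r$ distinct elements of $\Phi$, $f_k\in A$, satisfying (1) $\deg\phi_k+\deg f_k\le n$ for $k=1,\dots,r$, and (2) $\|g\|^2=\|f_1\|^2+\dots+\|f_r\|^2$. *)

(* Defs.v *)
From HB Require Import structures.
From mathcomp Require Import all_boot all_order all_algebra.
(* mpoly has to be imported before topology: in the other order their notation
   levels clash. *)
From mathcomp Require Import mpoly.
From mathcomp Require Import sesquilinear complex.
From mathcomp Require Import boolp classical_sets reals topology normedtype.

Set Implicit Arguments.
Unset Strict Implicit.
Unset Printing Implicit Defensive.

Import Order.TTheory GRing.Theory Num.Theory.
Import numFieldNormedType.Exports.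

Local Open Scope classical_set_scope.
Local Open Scope ring_scope.

Section LinearAlgebra.
Variables (K : nzRingType) (V : lmodType K).

Definition lin_span (S : set V) : set V :=
  [set v | exists (r : nat) (c : 'I_r -> K) (u : 'I_r -> V),
     (forall k, S (u k)) /\ v = \sum_(k < r) c k *: u k].

Definition lin_indep (S : set V) : Prop :=
  forall (r : nat) (c : 'I_r -> K) (u : 'I_r -> V),
    injective u -> (forall k, S (u k)) ->
    \sum_(k < r) c k *: u k = 0 -> forall k, c k = 0.

End LinearAlgebra.

Section MetricBases.
Variables (R : realType) (d : nat).
Local Notation C := R[i].
Local Notation A := {mpoly C[d]}.

Definition is_ideal (I : set A) : Prop :=
  [/\ I 0, (forall p q, I p -> I q -> I (p + q)) & (forall f p, I p -> I (f * p))].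

Definition is_graded_ideal (I : set A) : Prop :=
  is_ideal I /\ I `<=` lin_span [set p | I p /\ p \is homog mdeg].

Definition fock_weight (m : 'X_{1..d}) : C :=
  (\prod_(i < d) (m i)`!)%:R / (mdeg m)`!%:R.

(* The sesquilinear extension of <z^a, z^b> = delta_{a,b} a!/|a|!.  *)
Definition fock_dot (p q : A) : C :=
  \sum_(m <- msupp p) p@_m * (q@_m)^* * fock_weight m.

Definition fock_sqnorm (p : A) : C := fock_dot p p.

(* The degree of 0 is read as 0. *)
Definition degree (p : A) : nat := (msize p).-1.

Definition is_generator (I Phi : set A) : Prop :=
  [/\ Phi `<=` I,
      (forall phi, Phi phi -> phi \is homog mdeg),
      lin_indep Phi &
      forall g, I g -> exists (r : nat) (f phi : 'I_r -> A),
        (forall k, Phi (phi k)) /\ g = \sum_(k < r) f k * phi k].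

Definition is_contractive (Phi : set A) : Prop :=
  forall (r : nat) (f phi : 'I_r -> A),
    injective phi -> (forall k, Phi (phi k)) ->
    fock_sqnorm (\sum_(k < r) f k * phi k) <= \sum_(k < r) fock_sqnorm (f k).

Definition is_metric_basis (I Phi : set A) : Prop :=
  [/\ is_generator I Phi,
      is_contractive Phi &
      forall g, I g -> exists (r : nat) (f phi : 'I_r -> A),
        [/\ injective phi /\ (forall k, Phi (phi k)),
            g = \sum_(k < r) f k * phi k,
            (forall k, (degree (phi k) + degree (f k) <= degree g)%N) &
            fock_sqnorm g = \sum_(k < r) fock_sqnorm (f k)]].

Section Fock.
Variables (H : completeNormedModType C) (dot : {dot H for (@Num.conj C)}).

Definition is_fock_space (iota : {linear A -> H}) : Prop :=
  [/\ (forall x : H, `|x| ^+ 2 = dot x x),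
      (forall p q : A, dot (iota p) (iota q) = fock_dot p q) &
      dense (range iota)].

(* Multiplication by z_k on H: the continuous extension of p |-> z_k p from the
   dense subspace of polynomials. *)
Definition is_multiplication (iota : {linear A -> H}) (k : 'I_d)
    (S : {linear H -> H}) : Prop :=
  continuous S /\ forall p : A, S (iota p) = iota ('X_k * p).

(* An operator on a subspace M of H is a function H -> H of which only the
   values on M matter. *)
Definition is_bounded_operator_on (M : set H) (T : H -> H) : Prop :=
  [/\ (forall x, M x -> M (T x)),
      (forall (a : C) x y, M x -> M y -> T (a *: x + y) = a *: T x + T y) &
      exists B : C, forall x, M x -> `|T x| <= B * `|x|].

Definition is_adjoint_on (M : set H) (T Tadj : H -> H) : Prop :=
  is_bounded_operator_on M Tadj /\
  forall x y, M x -> M y -> dot (T x) y = dot x (Tadj y).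

(* 0 <= z in C entails that z is real. *)
Definition is_positive_on (M : set H) (D : H -> H) : Prop :=
  forall x, M x -> 0 <= dot (D x) x.

Definition is_positive_sqrt_on (M : set H) (Delta D : H -> H) : Prop :=
  [/\ is_bounded_operator_on M Delta,
      is_positive_on M Delta &
      forall x, M x -> Delta (Delta x) = D x].

Definition is_defect_operator (M : set H) (T Tadj : 'I_d -> H -> H)
    (Delta : H -> H) : Prop :=
  is_positive_sqrt_on M Delta (fun x => x - \sum_(k < d) T k (Tadj k x)).

Definition homog_part (iota : {linear A -> H}) (G : set H) (n : nat) : set H :=
  G `&` iota @` [set p | p \is n.-homog].

(* Algebraic span: only meant for finite-dimensional V. *)
Definition is_orthonormal_basis (V B : set H) : Prop :=
  [/\ B `<=` V,
      (forall x y, B x -> B y -> dot x y = (x == y)%:R) &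
      V `<=` lin_span B].

Definition is_eigenvector (T : H -> H) (x : H) : Prop :=
  x != 0 /\ exists a : C, T x = a *: x.

End Fock.
End MetricBases.

(* Main.v *)
Require Import Defs.
From HB Require Import structures.
From mathcomp Require Import all_boot all_order all_algebra.
From mathcomp Require Import ssrcomplements mpoly.
From mathcomp Require Import sesquilinear spectral complex ring.
From mathcomp Require Import boolp classical_sets reals topology normedtype.

(* The algebraic core is that the row of multiplications
   [(f_phi) |-> sum_phi f_phi phi] is a coisometry onto the ideal.  Since
   [1 = sum_k T_k T_k^* + Delta^2] on [M], one has
   [<x, y> = sum_k <T_k^* x, T_k^* y> + <Delta x, Delta y>].  For [phi = Delta psi]
   let [h_phi x] be the image of [x] under the adjoint of multiplication by
   [phi]; then [h_phi (T_k^* x)] is the backward shift of [h_phi x], and the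
   constant term of [h_phi x] is [<Delta x, psi>].  Induction on the degree, with
   Parseval for the [psi], gives [<x, y> = sum_phi <h_phi x, h_phi y>] for
   polynomials in [I].  Hence [x = sum_phi (h_phi x) phi] with the norm identity
   and the degree bound, and contractivity follows from Bessel's inequality.
   That [Delta] preserves the part [M_n] of degree [n] of [M] needs no uniqueness
   of square roots: [Delta^2] is graded, hence diagonalizable on the
   finite-dimensional [M_n], and positivity forces an eigenvector of [Delta^2] to
   be an eigenvector of [Delta]. *)

Set Implicit Arguments.
Unset Strict Implicit.
Unset Printing Implicit Defensive.

Import Order.TTheory GRing.Theory Num.Theory.
Import numFieldNormedType.Exports.

Local Open Scope classical_set_scope.
Local Open Scope ring_scope.

(** * Orthonormal lists and positive operators *)

(** Maximal orthonormal lists come from this, with a dimension as the bound; maximality then forces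
    completeness. *)
Lemma max_size_seq (T : Type) (P : seq T -> Prop) (N : nat) :
  P [::] -> (forall s, P s -> (size s <= N)%N) ->
  exists2 s, P s & forall s', P s' -> (size s' <= size s)%N.
Proof.
move=> P0 PN; pose Q n := `[< exists2 s, P s & size s = n >].
have exQ : exists n, Q n by exists 0%N; apply/asboolP; exists [::].
have leQ n : Q n -> (n <= N)%N by move=> /asboolP[s Ps <-]; exact: PN.
case: (ex_maxnP exQ leQ) => n /asboolP[s Ps <-] maxn; exists s => // s' Ps'.
by apply: maxn; apply/asboolP; exists s'.
Qed.

Definition is_subspace (K : nzRingType) (V : lmodType K) (W : set V) : Prop :=
  W 0 /\ forall a x y, W x -> W y -> W (a *: x + y).

Section Subspace.
Variables (K : nzRingType) (V : lmodType K) (W : set V).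
Hypothesis hW : is_subspace W.

Lemma subspaceD x y : W x -> W y -> W (x + y).
Proof. by move=> Wx Wy; rewrite -[x]scale1r; apply: hW.2. Qed.

Lemma subspaceZ a x : W x -> W (a *: x).
Proof. by move=> Wx; rewrite -[_ *: _]addr0; apply: hW.2 => //; case: hW. Qed.

Lemma subspaceB x y : W x -> W y -> W (x - y).
Proof.
by move=> Wx Wy; rewrite -scaleN1r; apply: subspaceD => //; apply: subspaceZ.
Qed.

Lemma subspace_sum (I : Type) (r : seq I) (P : pred I) (F : I -> V) :
  (forall i, P i -> W (F i)) -> W (\sum_(i <- r | P i) F i).
Proof. by move=> WF; apply: big_ind => //; [case: hW | exact: subspaceD]. Qed.

End Subspace.

Section LinSpan.
Variables (K : nzRingType) (V : lmodType K).
Implicit Types (S T : set V) (x y : V).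

Lemma lin_span0 S : lin_span S 0.
Proof.
by exists 0%N, (fun=> 0), (fun=> 0); split=> [[]//|]; rewrite big_ord0.
Qed.

Lemma lin_spanD S x y : lin_span S x -> lin_span S y -> lin_span S (x + y).
Proof.
move=> [m [a [u [Su ->]]]] [n [b [v [Sv ->]]]].
exists (m + n)%N, (fun k => match split k with inl i => a i | inr j => b j end),
  (fun k => match split k with inl i => u i | inr j => v j end).
split=> [k|]; first by case: split.
rewrite big_split_ord /=; congr (_ + _); apply: eq_bigr => i _.
  by rewrite -[lshift _ _]/(unsplit (inl i)) unsplitK.
by rewrite -[rshift _ _]/(unsplit (inr i)) unsplitK.
Qed.

Lemma lin_span_sum S (J : Type) (r : seq J) (P : pred J) (F : J -> V) :
  (forall j, P j -> lin_span S (F j)) -> lin_span S (\sum_(j <- r | P j) F j).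
Proof.
by move=> SF; apply: big_ind => //; [exact: lin_span0 | exact: lin_spanD].
Qed.

Lemma lin_span_sub S T : S `<=` T -> lin_span S `<=` lin_span T.
Proof.
by move=> ST _ [r [c [u [Su ->]]]]; exists r, c, u; split=> // k; apply: ST.
Qed.

End LinSpan.

Section DotSpace.
Variables (C : numClosedFieldType) (V : lmodType C).
Variable dot : {dot V for (@Num.conj C)}.
Implicit Types (s : seq V) (u v x y : V).

Lemma dotC u v : dot u v = (dot v u)^*.
Proof. by rewrite (hermC dot) expr0 mul1r. Qed.

Lemma dotZl a u v : dot (a *: u) v = a * dot u v.
Proof. exact: linearZl_LR. Qed.

Lemma dotZr a u v : dot u (a *: v) = a^* * dot u v.
Proof. by rewrite linearZr_LR. Qed.

Lemma dot_eq0C u v : dot u v = 0 -> dot v u = 0.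
Proof. by move=> uv0; rewrite dotC uv0 conjC0. Qed.

Lemma dot_suml (I : Type) (r : seq I) (P : pred I) (F : I -> V) v :
  dot (\sum_(i <- r | P i) F i) v = \sum_(i <- r | P i) dot (F i) v.
Proof. exact: linear_sumlz. Qed.

Lemma dot_sumr (I : Type) (r : seq I) (P : pred I) (F : I -> V) v :
  dot v (\sum_(i <- r | P i) F i) = \sum_(i <- r | P i) dot v (F i).
Proof. exact: linear_sumr. Qed.

Lemma dot_orthonormal s u v : orthonormal dot s -> u \in s -> v \in s ->
  dot u v = (u == v)%:R.
Proof. by move=> /orthonormalP[_ +]; apply. Qed.

Lemma orthonormal_cons u s : dot u u = 1 -> (forall v, v \in s -> dot u v = 0) ->
  orthonormal dot s -> orthonormal dot (u :: s).
Proof.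
move=> u1 us0 /orthonormalP[s_uniq s_on]; apply/orthonormalP; split => /=.
  rewrite s_uniq andbT; apply/negP => us; have := us0 _ us.
  by rewrite u1 => /eqP; rewrite oner_eq0.
move=> v w; rewrite !inE => /orP[/eqP->|vs] /orP[/eqP->|ws].
- by rewrite eqxx u1.
- rewrite us0//; case: eqP => // uw; have := us0 _ ws.
  by rewrite -uw u1 => /eqP; rewrite oner_eq0.
- rewrite (dot_eq0C (us0 _ vs)); case: eqP => // uw; have := us0 _ vs.
  by rewrite uw u1 => /eqP; rewrite oner_eq0.
- exact: s_on.
Qed.

Lemma orthonormal_coord s (c : V -> C) u : orthonormal dot s -> u \in s ->
  dot (\sum_(v <- s) c v *: v) u = c u.
Proof.
move=> s_on us; rewrite dot_suml.
rewrite (bigD1_seq u)//=; last by have /orthonormalP[] := s_on.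
rewrite dotZl (dot_orthonormal s_on)// eqxx mulr1 big_seq_cond big1 ?addr0//.
move=> v /andP[vs vu].
by rewrite dotZl (dot_orthonormal s_on)// (negPf vu) mulr0.
Qed.

(** The coordinate rows of the entries are independent, since pairing a vanishing combination with
    an entry isolates its coefficient. Hence there are no more rows than columns. *)
Lemma orthonormal_size (J : finType) (e : J -> V) s :
  (forall u, u \in s -> exists c : J -> C, u = \sum_j c j *: e j) ->
  orthonormal dot s -> (size s <= #|J|)%N.
Proof.
move=> span_s s_on.
have /choice[c cE] : forall i : 'I_(size s),
    exists c : J -> C, s`_i = \sum_j c j *: e j.
  by move=> i; apply: span_s; rewrite mem_nth.
pose M := \matrix_(i < size s, j < #|J|) c i (enum_val j).
suff /row_freeP[B MB] : row_free M.
  rewrite -[leqLHS](mxrank1 C) -MB; apply: leq_trans (mxrankM_maxl _ _) _.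
  exact: rank_leq_col.
apply: inj_row_free => v vM0; apply/rowP => k; rewrite mxE.
have sum0 : \sum_(i < size s) v 0 i *: s`_i = 0.
  under eq_bigr do rewrite cE scaler_sumr.
  rewrite exchange_big /= big1// => j _.
  have := congr1 (fun A : 'rV_ _ => A 0 (enum_rank j)) vM0.
  rewrite !mxE => {}vM0; rewrite -[RHS](scale0r (e j)) -vM0 scaler_suml.
  by apply: eq_bigr => i _; rewrite scalerA !mxE enum_rankK.
have /(congr1 (dot^~ s`_k)) := sum0; rewrite linear0l dot_suml (bigD1 k)//=.
have /orthonormalP[s_uniq _] := s_on.
rewrite dotZl (dot_orthonormal s_on) ?mem_nth// eqxx mulr1 big1 ?addr0//.
move=> i ik; rewrite dotZl (dot_orthonormal s_on) ?mem_nth//.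
by rewrite nth_uniq// -(inj_eq val_inj) /= in ik *; rewrite (negPf ik) mulr0.
Qed.

(** A list of elements of [B] of maximal length exhausts [B], because any further element could be
    prepended. *)
Lemma orthonormal_finite (J : finType) (e : J -> V) (B : set V) :
  (forall u, B u -> exists c : J -> C, u = \sum_j c j *: e j) ->
  (forall u v, B u -> B v -> dot u v = (u == v)%:R) ->
  exists2 s, orthonormal dot s & forall u, (u \in s) <-> B u.
Proof.
move=> spanB B_on.
have [||s [s_on sB] s_max] := @max_size_seq V
    (fun s => orthonormal dot s /\ forall u, u \in s -> B u) #|J|.
- by split.
- by move=> s [s_on sB]; apply: (orthonormal_size (e := e)) s_on => u /sB/spanB.
exists s => // u; split=> [|Bu]; first exact: sB.
apply: contrapT => /negP us.
suff /s_max : orthonormal dot (u :: s) /\ forall v, v \in u :: s -> B v.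
  by rewrite /= ltnn.
split; last by move=> v; rewrite inE => /orP[/eqP->//|/sB].
apply: orthonormal_cons => //; first by rewrite B_on// eqxx.
move=> v vs; rewrite B_on//; last exact: sB.
by case: eqP us => // ->; rewrite vs.
Qed.

(** For a maximal orthonormal list in [W], the remainder [y] of [x] after projection must vanish, or
    its normalization could be prepended. *)
Lemma orthonormal_basis_exists (J : finType) (e : J -> V) (W : set V) :
  is_subspace W ->
  (forall u, W u -> exists c : J -> C, u = \sum_j c j *: e j) ->
  exists2 s, orthonormal dot s /\ (forall u, u \in s -> W u) &
    forall x, W x -> x = \sum_(u <- s) dot x u *: u.
Proof.
move=> W_sub spanW.
have [||s [s_on sW] s_max] := @max_size_seq V
    (fun s => orthonormal dot s /\ forall u, u \in s -> W u) #|J|.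
- by split.
- by move=> s [s_on sB]; apply: (orthonormal_size (e := e)) s_on => u /sB/spanW.
exists s => // x Wx; apply/eqP; rewrite -subr_eq0; apply: contrapT => /negP y0.
set y := x - _ in y0.
have Wy : W y.
  apply: subspaceB => //; rewrite big_seq_cond.
  by apply: subspace_sum => // u /andP[/sW Wu _]; apply: subspaceZ.
have ys u : u \in s -> dot y u = 0.
  by move=> us; rewrite /y linearBl /= (orthonormal_coord _ s_on)// subrr.
pose u := (sqrtC (dot y y))^-1 *: y.
suff /s_max : orthonormal dot (u :: s) /\ forall v, v \in u :: s -> W v.
  by rewrite /= ltnn.
have r0 : sqrtC (dot y y) != 0 by rewrite sqrtC_eq0 (dnorm_eq0 dot).
split; last first.
  by move=> v; rewrite inE => /orP[/eqP->|/sW//]; exact: subspaceZ W_sub _ _ Wy.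
apply: orthonormal_cons => //; last first.
  by move=> v vs; rewrite /u dotZl (ys _ vs) mulr0.
rewrite /u (dnormZ dot) normfV exprVn ger0_norm ?sqrtC_ge0 ?(dnorm_ge0 dot)//.
by rewrite sqrtCK mulVf ?(dnorm_eq0 dot).
Qed.

Lemma dot_parseval s x y (B : set V) : orthonormal dot s ->
  (forall u, u \in s <-> B u) -> lin_span B x ->
  dot x y = \sum_(u <- s) dot x u * dot u y.
Proof.
move=> s_on sB [r [c [w [Bw ->]]]]; rewrite dot_suml.
under [RHS]eq_bigr do rewrite dot_suml mulr_suml.
rewrite exchange_big /=; apply: eq_bigr => k _.
have ws : w k \in s by apply/sB.
rewrite (bigD1_seq (w k))//=; last by have /orthonormalP[] := s_on.
rewrite !dotZl (dot_orthonormal s_on ws ws) eqxx mulr1 big_seq_cond big1 ?addr0//.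
move=> v /andP[vs vu].
by rewrite dotZl (dot_orthonormal s_on ws vs) eq_sym (negPf vu) mulr0 mul0r.
Qed.


(** The matrix of [D] in the orthonormal list [s] is Hermitian; the rows of the unitary matrix that
    diagonalizes it are the coordinates of the eigenvectors. *)
Lemma symmetric_diagonalizable (W : set V) (D : V -> V) s : is_subspace W ->
  orthonormal dot s -> (forall u, u \in s -> W u) ->
  (forall x, W x -> x = \sum_(u <- s) dot x u *: u) ->
  (forall x, W x -> W (D x)) ->
  (forall c : 'I_(size s) -> C, D (\sum_i c i *: s`_i) = \sum_i c i *: D s`_i) ->
  (forall x y, W x -> W y -> dot (D x) y = dot x (D y)) ->
  exists (f : 'I_(size s) -> V) (lambda : 'I_(size s) -> C),
    (forall i, W (f i) /\ D (f i) = lambda i *: f i) /\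
    forall x, W x -> exists c, x = \sum_i c i *: f i.
Proof.
move=> W_sub s_on sW s_exp DW D_lin D_sym.
have sW' (i : 'I_(size s)) : W s`_i by apply: sW; rewrite mem_nth.
have s_exp' x : W x -> x = \sum_(i < size s) dot x s`_i *: s`_i.
  by move=> Wx; rewrite {1}(s_exp _ Wx) (big_nth 0) big_mkord.
pose A := \matrix_(i < size s, j < size s) dot (D s`_i) s`_j.
have A_herm : A \is hermsymmx.
  apply/is_hermitianmxP; rewrite expr0 scale1r; apply/matrixP => i j.
  by rewrite !mxE D_sym// [LHS]dotC.
have := A_herm => /hermitian_normalmx /orthomx_spectralP.
set P := spectralmx A; set sp := spectral_diag A => AE.
have Pu : P \in unitmx by exact: spectral_unit.
have PA : P *m A = diag_mx sp *m P by rewrite {1}AE !mulmxA mulmxV// mul1mx.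
exists (fun k => \sum_i P k i *: s`_i), (fun k => sp 0 k); split=> [k|x Wx].
  split; first by apply: subspace_sum => // i _; apply: subspaceZ.
  rewrite D_lin//.
  under eq_bigr => i _.
    rewrite (s_exp' (D s`_i)); last exact: DW.
    rewrite scaler_sumr; under eq_bigr do rewrite scalerA.
    over.
  rewrite exchange_big scaler_sumr /=; apply: eq_bigr => j _.
  rewrite scalerA -scaler_suml; congr (_ *: _).
  have := congr1 (fun B : 'M_ _ => B k j) PA; rewrite mul_diag_mx !mxE => <-.
  by apply: eq_bigr => i _; rewrite mxE.
(* The coordinate row of [x] times the inverse of [P]. *)
exists (fun k => \sum_(i < size s) dot x s`_i * invmx P i k).
rewrite {1}(s_exp' _ Wx).
under [RHS]eq_bigr do rewrite scaler_suml.
rewrite exchange_big /=; apply: eq_bigr => i _.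
under eq_bigr do rewrite -scalerA scaler_sumr.
rewrite -scaler_sumr; congr (_ *: _); rewrite exchange_big /=.
transitivity (\sum_j (invmx P *m P) i j *: s`_j).
  rewrite mulVmx// (bigD1 i)//= mxE eqxx scale1r big1 ?addr0// => j ji.
  by rewrite mxE eq_sym (negPf ji) scale0r.
apply: eq_bigr => j _; rewrite mxE scaler_suml.
by apply: eq_bigr => k _; rewrite scalerA.
Qed.

(** * Positive square roots on a subspace *)

Section PositiveSquareRoot.
Variables (M : set V) (Delta : V -> V).
Hypothesis M_sub : is_subspace M.
Hypothesis DeltaM : forall x, M x -> M (Delta x).
Hypothesis Delta_lin :
  forall a x y, M x -> M y -> Delta (a *: x + y) = a *: Delta x + Delta y.
Hypothesis Delta_ge0 : forall x, M x -> 0 <= dot (Delta x) x.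

Lemma lin_on0 : Delta 0 = 0.
Proof.
have M0 := M_sub.1; have := Delta_lin (-1) M0 M0.
by rewrite scaler0 addr0 scaleN1r addNr.
Qed.

Lemma lin_onD x y : M x -> M y -> Delta (x + y) = Delta x + Delta y.
Proof. by move=> Mx My; rewrite -[x]scale1r Delta_lin// !scale1r. Qed.

Lemma lin_onZ a x : M x -> Delta (a *: x) = a *: Delta x.
Proof.
move=> Mx; rewrite -[a *: x]addr0 Delta_lin//; last by case: M_sub.
by rewrite lin_on0 addr0.
Qed.

Lemma lin_onB x y : M x -> M y -> Delta (x - y) = Delta x - Delta y.
Proof.
move=> Mx My; rewrite -scaleN1r lin_onD ?lin_onZ ?scaleN1r//.
by rewrite -[- y]scaleN1r; apply: subspaceZ.
Qed.

Lemma lin_on_sum (I : Type) (r : seq I) (P : pred I) (F : I -> V) :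
  (forall i, P i -> M (F i)) ->
  Delta (\sum_(i <- r | P i) F i) = \sum_(i <- r | P i) Delta (F i).
Proof.
move=> MF; suff [] : M (\sum_(i <- r | P i) F i) /\
  Delta (\sum_(i <- r | P i) F i) = \sum_(i <- r | P i) Delta (F i) by [].
apply: (big_ind2 (fun x y => M x /\ Delta x = y)).
- by split; [case: M_sub | exact: lin_on0].
- move=> x1 x2 y1 y2 [Mx <-] [My <-]; split; last exact: lin_onD.
  exact: subspaceD.
- by move=> i Pi; split=> //; exact: MF.
Qed.

(* Polarization: over C a form whose diagonal is real is Hermitian. *)
Lemma positive_symmetric x y : M x -> M y ->
  dot (Delta x) y = dot x (Delta y).
Proof.
move=> Mx My; rewrite [RHS]dotC.
set s := dot (Delta x) y; set t := dot (Delta y) x.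
have real_dot z : M z -> (dot (Delta z) z)^* = dot (Delta z) z.
  by move=> Mz; apply/CrealP/ger0_real/Delta_ge0.
(* The form is real at [x + c *: y], at [x] and at [y], so the sum of the cross terms is real. *)
have st c : c^* * s + c * t = (c^* * s + c * t)^*.
  have Mcy : M (c *: y) by exact: subspaceZ.
  have := real_dot _ (subspaceD M_sub Mx Mcy).
  have -> : dot (Delta (x + c *: y)) (x + c *: y) =
      dot (Delta x) x + c * c^* * dot (Delta y) y + (c^* * s + c * t).
    rewrite lin_onD// lin_onZ// linearDl !linearDr /= !dotZl !dotZr.
    by rewrite -/s -/t; ring.
  by rewrite rmorphD rmorphD !rmorphM /= conjCK !real_dot// (mulrC c^*) => /addrI.
(* The values 1 and ['i] of [c] together determine [s] as the conjugate of [t]. *)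
have := st 1; have := st 'i.
rewrite !rmorphD !rmorphM /= !conjCK conjC1 !mul1r conjCi => eq_i eq_1.
suff /(mulfI (@neq0Ci C)) : 'i * s = 'i * t^* by [].
have two0 : 2 != 0 :> C by rewrite pnatr_eq0.
apply: (mulfI two0).
have -> : 2 * ('i * s) = 'i * (s + t) - (- 'i * s + 'i * t) by ring.
by rewrite eq_1 eq_i; ring.
Qed.

(* [Delta x = sqrt lambda *: x], because [y := Delta x - sqrt lambda *: x]
   satisfies [Delta y = - sqrt lambda *: y] while [Delta] is positive. *)
Lemma positive_sqrt_eigen x lambda : M x ->
  Delta (Delta x) = lambda *: x -> exists mu, Delta x = mu *: x.
Proof.
move=> Mx DDx; have MDx := DeltaM Mx.
have sqD : dot (Delta x) (Delta x) = lambda * dot x x.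
  by rewrite -positive_symmetric// DDx dotZl.
have [->|x0] := eqVneq x 0; first by exists 0; rewrite lin_on0 scaler0.
have lambda_ge0 : 0 <= lambda.
  have xx : 0 < dot x x by rewrite (dnorm_gt0 dot).
  by rewrite -(pmulr_lge0 _ xx) -sqD (dnorm_ge0 dot).
(* The argument with [y] needs a strictly positive root; for [lambda = 0] the vector [Delta x] has
   norm zero. *)
exists (sqrtC lambda); have := lambda_ge0; rewrite le0r => /orP[/eqP l0|lambda_gt0].
  rewrite l0 sqrtC0 scale0r; apply/eqP.
  by rewrite -(dnorm_eq0 dot) sqD l0 mul0r.
apply/eqP; rewrite -subr_eq0; set y := _ - _.
have My : M y by apply: subspaceB => //; exact: subspaceZ.
have Dy : Delta y = - sqrtC lambda *: y.
  rewrite /y lin_onB// ?lin_onZ//; last exact: subspaceZ.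
  by rewrite DDx -{1}(sqrtCK lambda) scalerBr !scaleNr opprK scalerA -expr2 addrC.
have := Delta_ge0 My; rewrite Dy dotZl mulNr oppr_ge0.
rewrite pmulr_rle0 ?sqrtC_gt0// => yy_le0.
by rewrite -(dnorm_eq0 dot) eq_le yy_le0 (dnorm_ge0 dot).
Qed.

(** Eigenvectors of the square of [Delta] span [W]; each is also an eigenvector of [Delta], so its
    image stays in [W]. *)
Lemma positive_sqrt_invariant (W : set V) s :
  W `<=` M -> is_subspace W ->
  orthonormal dot s -> (forall u, u \in s -> W u) ->
  (forall x, W x -> x = \sum_(u <- s) dot x u *: u) ->
  (forall x, W x -> W (Delta (Delta x))) ->
  forall x, W x -> W (Delta x).
Proof.
move=> WM W_sub s_on sW s_exp DDW x Wx.
have MD u : M u -> M (Delta u) by exact: DeltaM.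
have [f [lambda [fE f_exp]]] : exists (f : 'I_(size s) -> V)
    (lambda : 'I_(size s) -> C),
    (forall i, W (f i) /\ Delta (Delta (f i)) = lambda i *: f i) /\
    forall x, W x -> exists c, x = \sum_i c i *: f i.
  apply: (symmetric_diagonalizable (D := fun x => Delta (Delta x)) W_sub s_on);
    move=> //.
  - move=> c; have Mc i : M (c i *: s`_i).
      by apply: subspaceZ => //; apply/WM/sW; rewrite mem_nth.
    rewrite lin_on_sum// lin_on_sum; last by move=> i _; apply: MD.
    apply: eq_bigr => i _.
    by rewrite !lin_onZ//; [apply/MD/WM/sW | apply/WM/sW]; rewrite mem_nth.
  - by move=> u v /WM Mu /WM Mv; rewrite !positive_symmetric//; exact: MD.
have [c ->] := f_exp _ Wx.
have Wf i : W (c i *: f i) by apply: subspaceZ => //; case: (fE i).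
rewrite lin_on_sum; last by move=> i _; exact: WM.
apply: subspace_sum => // i _; have [Wfi DDf] := fE i.
have [mu fmu] := positive_sqrt_eigen (WM _ Wfi) DDf.
by rewrite lin_onZ; [rewrite fmu; do 2!apply: (subspaceZ W_sub) | exact: WM].
Qed.
End PositiveSquareRoot.
End DotSpace.

(** * The symmetric Fock inner product on polynomials *)

Section Fock.
Variables (R : realType) (d : nat).
Local Notation C := R[i].
Local Notation A := {mpoly C[d]}.
Implicit Types (p q : A) (m : 'X_{1..d}).

Lemma fock_weight_gt0 m : 0 < fock_weight R m.
Proof.
rewrite divr_gt0// ltr0n ?fact_gt0//.
by rewrite prodn_gt0// => i; rewrite fact_gt0.
Qed.

Lemma fock_weight_neq0 m : fock_weight R m != 0.
Proof. by rewrite gt_eqF ?fock_weight_gt0. Qed.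

Lemma fock_weight_real m : (fock_weight R m)^* = fock_weight R m.
Proof. exact/CrealP/ger0_real/ltW/fock_weight_gt0. Qed.

Lemma fock_weight0 : fock_weight R (0%MM : 'X_{1..d}) = 1.
Proof.
rewrite /fock_weight mdeg0 fact0 divr1 big1// => i _.
by rewrite mnm0E.
Qed.

(** Dividing out, raising the exponent at [k] scales the weight by a ratio of the form
    [m k / mdeg m]. These ratios add up to 1 over [k], which is the property of this norm that
    [fock_shift_sum] exploits. *)
Lemma fock_weightD1 m (k : 'I_d) :
  fock_weight R (U_(k) + m)%MM * (mdeg m).+1%:R = fock_weight R m * (m k).+1%:R.
Proof.
rewrite /fock_weight mdegD mdeg1 add1n factS natrM.
rewrite (bigD1 k)//= mnmDE mnm1E eqxx add1n factS.
rewrite (eq_bigr (fun i => (m i)`!)); last first.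
  by move=> i ik; rewrite mnmDE mnm1E eq_sym (negPf ik).
rewrite [in RHS](bigD1 k)//= !natrM.
have S0 : (mdeg m).+1%:R != 0 :> C by rewrite pnatr_eq0.
have F0 : (mdeg m)`!%:R != 0 :> C by rewrite pnatr_eq0 -lt0n fact_gt0.
by field; rewrite nat1r S0 F0.
Qed.

(** A common index set, independent of the supports, on which forms of different polynomials can be
    added or compared. *)
Lemma fock_dotwE k p q : (msize p <= k)%N ->
  fock_dot p q = \sum_(m : 'X_{1..d < k}) p@_m * (q@_m)^* * fock_weight R m.
Proof.
move=> lt_pk; pose I : subFinType _ := 'X_{1..d < k}.
rewrite /fock_dot (big_mksub I) //=; first last.
- by move=> x /msize_mdeg_lt /leq_trans; apply.
- by rewrite msupp_uniq.
by rewrite big_rmcond //= => i /memN_msupp_eq0 ->; rewrite !mul0r.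
Qed.

Lemma fock_dot_linearl q a p p' :
  fock_dot (a *: p + p') q = a * fock_dot p q + fock_dot p' q.
Proof.
pose k := maxn (msize (a *: p + p')) (maxn (msize p) (msize p')).
rewrite !(@fock_dotwE k) ?leq_max ?leqnn ?orbT// mulr_sumr -big_split/=.
by apply: eq_bigr => m _; rewrite mcoeffD mcoeffZ; ring.
Qed.

Lemma fock_dot_herm p q : fock_dot p q = (-1) ^+ false * (fock_dot q p)^*.
Proof.
pose k := maxn (msize p) (msize q).
rewrite expr0 mul1r !(@fock_dotwE k) ?leq_max ?leqnn ?orbT// rmorph_sum.
apply: eq_bigr => m _; rewrite 2!rmorphM /= conjCK fock_weight_real.
by congr (_ * _); rewrite mulrC.
Qed.

Lemma fock_dot_linearr p a q q' :
  fock_dot p (a *: q + q') = a^* * fock_dot p q + fock_dot p q'.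
Proof.
rewrite fock_dot_herm fock_dot_linearl rmorphD rmorphM.
by rewrite (fock_dot_herm p q) (fock_dot_herm p q') expr0 !mul1r.
Qed.

Lemma fock_dot_gt0 p : p != 0 -> 0 < fock_dot p p.
Proof.
move=> p0; have mp : mlead p \in msupp p by exact: mlead_supp.
rewrite /fock_dot (bigD1_seq (mlead p))//= ltr_wpDr//.
  apply: sumr_ge0 => m _; apply: mulr_ge0; first exact: mul_conjC_ge0.
  exact/ltW/fock_weight_gt0.
by apply: mulr_gt0 (fock_weight_gt0 _); rewrite mul_conjC_gt0 mleadc_eq0.
Qed.

Let fock_dot0l q : fock_dot 0 q = 0.
Proof. by rewrite /fock_dot msupp0 big_nil. Qed.

Let fock_dot0r p : fock_dot p 0 = 0.
Proof. by rewrite fock_dot_herm fock_dot0l rmorph0 mulr0. Qed.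

Let fock_zmodl q : zmod_morphism (@fock_dot R d ^~ q).
Proof.
move=> p p'; have := fock_dot_linearl q (-1) p' p.
by rewrite scaleN1r addrC mulN1r [in RHS]addrC.
Qed.

Let fock_zmodr p : zmod_morphism (@fock_dot R d p).
Proof.
move=> q q'; have := fock_dot_linearr p (-1) q' q.
by rewrite scaleN1r addrC rmorphN1 mulN1r [in RHS]addrC.
Qed.

Let fock_scalel q : scalable_for *%R (@fock_dot R d ^~ q).
Proof.
by move=> a p; have := fock_dot_linearl q a p 0; rewrite !addr0 fock_dot0l addr0.
Qed.

Let fock_scaler p : scalable_for (@Num.conj C \; *%R) (@fock_dot R d p).
Proof.
by move=> a q; have := fock_dot_linearr p a q 0; rewrite !addr0 fock_dot0r addr0.
Qed.

HB.instance Definition _ := @isBilinear.Build C A A C *%R (@Num.conj C \; *%R)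
  (@fock_dot R d) fock_zmodl fock_zmodr fock_scalel fock_scaler.
HB.instance Definition _ := @isHermitianSesquilinear.Build C A false
  (@Num.conj C) (@fock_dot R d) fock_dot_herm.
HB.instance Definition _ := @isDotProduct.Build C A (@fock_dot R d) fock_dot_gt0.

Definition fock : {dot A for (@Num.conj C)} := @fock_dot R d.
Arguments fock : simpl never.

Lemma fockX p m : fock p 'X_[m] = p@_m * fock_weight R m.
Proof.
change (fock p 'X_[m]) with (fock_dot p 'X_[m]); rewrite /fock_dot.
have [mp|mp] := boolP (m \in msupp p).
  rewrite (bigD1_seq m)//= mcoeffX eqxx conjC1 mulr1 big1 ?addr0// => m' m'm.
  by rewrite mcoeffX eq_sym (negPf m'm) conjC0 mulr0 mul0r.
rewrite (memN_msupp_eq0 mp) mul0r big_seq_cond big1// => m' /andP[m'p _].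
rewrite mcoeffX; case: eqP => [mm'|_]; last by rewrite conjC0 mulr0 mul0r.
by rewrite mm' m'p in mp.
Qed.

Lemma fock_disjoint p q : (forall m, m \in msupp p -> q@_m = 0) -> fock p q = 0.
Proof.
move=> pq; change (fock_dot p q = 0); rewrite /fock_dot big_seq_cond big1//.
by move=> m /andP[/pq-> _]; rewrite conjC0 mulr0 mul0r.
Qed.

Lemma fock_homog_orth j k p q : j != k -> p \is j.-homog -> q \is k.-homog ->
  fock p q = 0.
Proof.
move=> jk pj qk; apply: fock_disjoint => m mp.
by apply: (dhomog_nemf_coeff qk); rewrite (dhomog_mf pj mp).
Qed.

Lemma mcoeffXM (k : 'I_d) p m :
  ('X_k * p)@_m = if m k == 0%N then 0 else p@_(m - U_(k)).
Proof.
rewrite mulrC; case: ifPn => mk.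
  apply/memN_msupp_eq0; rewrite (perm_mem (msuppMX _ _)).
  apply/mapP => -[m' _ mE]; move: mk.
  by rewrite mE mnmDE mnm1E eqxx.
rewrite -{1}(@submK _ U_(k)%MM m) ?lep1mP//.
by rewrite addmC mcoeffMX.
Qed.

(* [b k] is the image of [g] under the adjoint of multiplication by [X_k]. *)
Lemma fock_shift_sum (g : A) (b : 'I_d -> A) :
  (forall k p, fock (b k) p = fock g ('X_k * p)) ->
  \sum_(k < d) 'X_k * b k = g - g@_0%MM *: 1.
Proof.
move=> gb; apply/mpolyP => m; rewrite linear_sum /= mcoeffB mcoeffZ mcoeff1.
have [->|m0] := eqVneq m 0%MM.
  by rewrite mulr1 subrr big1// => k _; rewrite mcoeffXM mnm0E.
rewrite mulr0 subr0.
have bE (k : 'I_d) : ('X_k * b k)@_m = g@_m * ((m k)%:R / (mdeg m)%:R).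
  rewrite mcoeffXM; case: eqP => [->|/eqP mk]; first by rewrite mul0r mulr0.
  pose m' := (m - U_(k))%MM.
  have mE : m = (U_(k) + m')%MM by rewrite addmC submK// lep1mP.
  have : fock (b k) 'X_[m'] = fock g 'X_[m] by rewrite gb -mpolyXD -mE.
  rewrite !fockX => eqb.
  have -> : mdeg m = (mdeg m').+1 by rewrite mE mdegD mdeg1.
  have -> : m k = (m' k).+1 by rewrite mE mnmDE mnm1E eqxx.
  have S0 : (mdeg m').+1%:R != 0 :> C by rewrite pnatr_eq0.
  apply: (mulIf (fock_weight_neq0 m')); rewrite eqb -mulrA; congr (_ * _).
  apply: (mulIf S0); rewrite {1}mE fock_weightD1.
  by field; rewrite nat1r.
under eq_bigr do rewrite bE.
rewrite -mulr_sumr -mulr_suml -natr_sum -mdegE divff ?mulr1//.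
by rewrite pnatr_eq0 mdeg_eq0.
Qed.

(** On the Fock space the identity is the sum of all shift times backward shift, plus the projection
    onto constants; this is that decomposition paired with [f] and [g]. *)
Lemma fock_shift_dot (f g : A) (a b : 'I_d -> A) :
  (forall k p, fock (a k) p = fock f ('X_k * p)) ->
  (forall k p, fock (b k) p = fock g ('X_k * p)) ->
  fock f g = f@_0%MM * (g@_0%MM)^* + \sum_(k < d) fock (a k) (b k).
Proof.
move=> fa gb; under eq_bigr do rewrite fa.
rewrite -dot_sumr (fock_shift_sum gb) linearBr /= dotZr.
by rewrite -mpolyX0 fockX fock_weight0 mulr1 (mulrC _^*) addrC subrK.
Qed.

(* [mult_adj phi x] is the image of [x] under the adjoint of multiplication
   by [phi]. *)
Definition mult_adj (phi x : A) : A :=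
  \sum_(m : 'X_{1..d < msize x})
    (fock x ('X_[m] * phi) / fock_weight R m) *: 'X_[m].

Lemma mult_adjP phi x p : fock (mult_adj phi x) p = fock x (p * phi).
Proof.
rewrite [p]mpolyE mulr_suml !dot_sumr; apply: eq_bigr => m _.
rewrite -scalerAl !dotZr; congr (_ * _); rewrite fockX.
have [mx|mx] := ltnP (mdeg m) (msize x).
  pose c m := fock x ('X_[m] * phi) / fock_weight R m.
  by rewrite (mcoeff_mpoly c mx) divfK ?fock_weight_neq0.
(* For monomials of degree at least [msize x] both sides vanish: on the left by truncation, on the
   right because the product with [phi] contains only monomials too large for [x]. *)
rewrite [X in X * _ = _]memN_msupp_eq0 ?mul0r; last first.
  apply/negP => /msupp_sum_le /flattenP[_ /mapP[m' _ ->]] /msuppZ_le.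
  by rewrite msuppX inE => /eqP mE; have := bmdeg m'; rewrite -mE ltnNge mx.
rewrite fock_disjoint// => m' /msize_mdeg_lt m'x; apply/memN_msupp_eq0/negP.
rewrite mulrC (perm_mem (msuppMX _ _)) => /mapP[m'' _ mE].
by move: m'x; rewrite mE mdegD ltnNge (leq_trans mx)// leq_addr.
Qed.

(** Otherwise ['X_[m] * phi] would be homogeneous of degree above that of [x], hence orthogonal to
    [x]. This yields the degree condition of a metric basis. *)
Lemma mult_adj_degree phi x n m : phi \is n.-homog ->
  m \in msupp (mult_adj phi x) -> (mdeg m + n < msize x)%N.
Proof.
move=> phin; rewrite mcoeff_msupp => hm; rewrite ltnNge; apply/negP => le_x.
have /eqP := mult_adjP phi x 'X_[m]; rewrite fockX fock_disjoint.
  by rewrite mulf_eq0 (negPf hm) (negPf (fock_weight_neq0 _)).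
move=> m' /msize_mdeg_lt m'x.
have Xphi : 'X_[m] * phi \is (mdeg m + n)%N.-homog.
  by apply: dhomogM => //; rewrite dhomogX.
by apply: (dhomog_nemf_coeff Xphi); rewrite ltn_eqF// (leq_trans m'x).
Qed.

End Fock.

(** * The coisometry identity and metric bases *)

Section MetricBasis.
Variables (R : realType) (d : nat).
Local Notation C := R[i].
Local Notation A := {mpoly C[d]}.
Local Notation fock := (@fock R d).

Lemma ideal_subspace (I : set A) : is_ideal I -> is_subspace I.
Proof.
move=> [I0 ID IM]; split=> // a x y Ix Iy.
by apply: ID => //; rewrite -mul_mpolyC; exact: IM.
Qed.

Lemma homog_msizeE n (p : A) : p != 0 -> p \is n.-homog -> msize p = n.+1.
Proof.
move=> p0 pn; rewrite -mlead_deg//; congr _.+1.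
exact: (dhomog_mf pn (mlead_supp p0)).
Qed.

(* [t k], [delta] and [P n] are [T_k^*], [Delta] and [Psi_n] read on polynomials;
   only the values of [t k] and [delta] on [I] matter. *)
Variables (I : set A) (t : 'I_d -> A -> A) (delta : A -> A) (P : nat -> set A).
Hypothesis I_ideal : is_ideal I.
Hypothesis tI : forall k x, I x -> I (t k x).
Hypothesis t_size : forall k x, I x -> (msize (t k x) <= (msize x).-1)%N.
Hypothesis t_adj : forall k x y, I x -> I y ->
  fock (t k x) y = fock x ('X_k * y).
Hypothesis deltaI : forall x, I x -> I (delta x).
Hypothesis delta_sym : forall x y, I x -> I y ->
  fock (delta x) y = fock x (delta y).
Hypothesis dot_split : forall x y, I x -> I y ->
  fock x y = \sum_(k < d) fock (t k x) (t k y) + fock (delta x) (delta y).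
Hypothesis PI : forall n p, P n p -> I p /\ p \is n.-homog.
Hypothesis P_on : forall n p q, P n p -> P n q -> fock p q = (p == q)%:R.
Hypothesis P_eigen : forall n p, P n p -> exists2 a : C, a != 0 & delta p = a *: p.
Hypothesis P_span : forall x, I x ->
  lin_span (\bigcup_(n in [set n | (n < msize x)%N]) P n) (delta x).

Local Notation Phi := (\bigcup_n (delta @` P n)).
Local Notation h psi x := (mult_adj (delta psi) x).

Let I_sub : is_subspace I := ideal_subspace I_ideal.

Lemma P_neq0 n p : P n p -> p != 0.
Proof.
move=> Pp; apply/eqP => p0; have := P_on Pp Pp.
by rewrite p0 linear0l eqxx => /eqP; rewrite eq_sym oner_eq0.
Qed.

(** Across two degrees both sides are zero, since a nonzero homogeneous polynomial has only one
    degree. *)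
Lemma P_orthonormal j k p q : P j p -> P k q -> fock p q = (p == q)%:R.
Proof.
move=> Pp Pq; have [jk|jk] := eqVneq j k.
  by rewrite -jk in Pq; exact: P_on Pq.
rewrite (fock_homog_orth jk (PI Pp).2 (PI Pq).2); case: eqP => // pq.
have := dhomog_uniq (P_neq0 Pp) (PI Pp).2; rewrite pq => /(_ _ (PI Pq).2).
by move/eqP; rewrite (negPf jk).
Qed.

Lemma delta_homog n p : P n p -> delta p != 0 /\ delta p \is n.-homog.
Proof.
move=> Pp; have [a a0 ->] := P_eigen Pp; split.
  by rewrite scaler_eq0 negb_or a0 (P_neq0 Pp).
by apply: dhomogZ; case: (PI Pp).
Qed.

(** On [P] the map [delta] only rescales. Linear independence of [Phi] and injectivity of [delta] on
    [P] rest on this. *)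
Lemma delta_orthogonal j k p q : P j p -> P k q -> p != q ->
  fock (delta p) (delta q) = 0.
Proof.
move=> Pp Pq pq; have [a _ ->] := P_eigen Pp; have [b _ ->] := P_eigen Pq.
by rewrite dotZl dotZr (P_orthonormal Pp Pq) (negPf pq) !mulr0.
Qed.

(** Truncation to degrees below [N] replaces the possibly infinite [Phi] by a finite list, which is
    enough for polynomials of size at most [N]. *)
Definition enumerates (s : seq A) (N : nat) : Prop := orthonormal fock s /\
  forall u, u \in s <-> (\bigcup_(n in [set n | (n < N)%N]) P n) u.

Lemma enumerates_exists N : exists s, enumerates s N.
Proof.
suff [s s_on sE] : exists2 s, orthonormal fock s &
    forall u, u \in s <-> (\bigcup_(n in [set n | (n < N)%N]) P n) u.
  by exists s.
apply: (orthonormal_finite (e := fun m : 'X_{1..d < N} => 'X_[m] : A)).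
  move=> u [n nN Pu]; exists (fun m : 'X_{1..d < N} => u@_m); apply: mpolywE.
  by rewrite (homog_msizeE (P_neq0 Pu) (PI Pu).2).
by move=> u v [n _ Pu] [n' _ Pv]; exact: P_orthonormal Pu Pv.
Qed.

(** Multiplications by ['X_k] and by [delta psi] commute, and [p * delta psi] lies in [I], where
    [t_adj] applies. *)
Lemma mult_adj_shift psi k x p : I psi -> I x ->
  fock (h psi (t k x)) p = fock (h psi x) ('X_k * p).
Proof.
move=> Ipsi Ix; rewrite !mult_adjP t_adj ?mulrA//.
by case: I_ideal => _ _ IM; apply/IM/deltaI.
Qed.

(** The constant term is the inner product with 1, and [delta] moves across by symmetry. *)
Lemma mult_adj_coeff0 psi x : I psi -> I x ->
  (h psi x)@_0%MM = fock (delta x) psi.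
Proof.
move=> Ipsi Ix; rewrite delta_sym// -[RHS](congr1 (fock x) (mul1r (delta psi))).
by rewrite -mult_adjP -mpolyX0 fockX fock_weight0 mulr1.
Qed.

(* The row of multiplications by the elements of [Phi] is a coisometry; the
   induction step splits off the constant terms, where Parseval applies. *)
Lemma coisometry N s : enumerates s N ->
  forall x y, I x -> I y -> (msize x <= N)%N -> (msize y <= N)%N ->
  fock x y = \sum_(psi <- s) fock (h psi x) (h psi y).
Proof.
move=> [s_on sE].
(* The induction runs on the size bound [n], while the list [s] stays fixed at level [N]. *)
suff main n : (n <= N)%N -> forall x y, I x -> I y ->
    (msize x <= n)%N -> (msize y <= n)%N ->
    fock x y = \sum_(psi <- s) fock (h psi x) (h psi y) by exact: main.
elim: n => [_ x y Ix Iy|n IHn nN x y Ix Iy xn yn].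
  rewrite leqn0 mmeasure_poly_eq0 => /eqP-> _; rewrite linear0l big1// => psi _.
  by rewrite mult_adjP linear0l.
have t_n k z : I z -> (msize z <= n.+1)%N -> (msize (t k z) <= n)%N.
  move=> Iz zn; apply: leq_trans (t_size k Iz) _.
  by rewrite -ltnS; case: (msize z) zn.
rewrite dot_split//.
have -> : fock (delta x) (delta y) =
    \sum_(psi <- s) fock (delta x) psi * fock psi (delta y).
  apply: (dot_parseval _ s_on sE).
  have [r [c [u [Pu ->]]]] := P_span Ix; exists r, c, u; split=> // k.
  have [m mx Pm] := Pu k; exists m => //=; apply: leq_trans mx _.
  exact: leq_trans xn nN.
under eq_bigr => k _.
  rewrite (IHn (ltnW nN)); [|exact: tI..|exact: t_n|exact: t_n].
  over.
rewrite exchange_big -big_split /= !big_seq; apply: eq_bigr => psi /sE[m _ Pm].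
have [Ipsi _] := PI Pm.
rewrite (@fock_shift_dot _ _ (h psi x) (h psi y) (fun k => h psi (t k x))
  (fun k => h psi (t k y))); try by move=> k p; exact: mult_adj_shift.
by rewrite !mult_adj_coeff0// -dotC addrC.
Qed.

Lemma mult_adj_msize N s psi x : enumerates s N -> psi \in s -> (msize x <= N)%N ->
  (msize (h psi x * delta psi) <= N)%N.
Proof.
move=> [_ sE] /sE[n _ Pn] xN; have [dpsi0 dpsin] := delta_homog Pn.
have [->|h0] := eqVneq (h psi x) 0; first by rewrite mul0r msize0.
rewrite msizeM// (homog_msizeE dpsi0 dpsin) addnS /= -mlead_deg// addSn.
exact: leq_trans (mult_adj_degree dpsin (mlead_supp h0)) xN.
Qed.

(** By [coisometry], the sum [u] and [g] have the same inner product with every element of [I] of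
    size at most [N]; their difference is itself such an element. *)
Lemma mult_adj_expansion N s g : enumerates s N -> I g -> (msize g <= N)%N ->
  g = \sum_(psi <- s) h psi g * delta psi.
Proof.
move=> sN Ig gN; apply/esym/eqP; rewrite -subr_eq0; set u := \sum_(_ <- _) _.
have IM f p : I p -> I (f * p) by case: I_ideal => _ _; apply.
have sI psi : psi \in s -> I psi by case: sN => _ sE /sE[n _ /PI[]].
have Iu : I u.
  rewrite /u big_seq; apply: subspace_sum => // psi /sI Ipsi.
  exact/IM/deltaI.
have uN : (msize u <= N)%N.
  rewrite /u big_seq; apply: leq_trans (mmeasure_sum _ _ _ _) _.
  by apply/bigmax_leqP_seq => psi _ psis; exact: (mult_adj_msize sN psis gN).
have uE y : I y -> (msize y <= N)%N -> fock u y = fock g y.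
  move=> Iy yN; rewrite (coisometry sN Ig Iy gN yN) dot_suml.
  by apply: eq_bigr => psi _; rewrite dotC -mult_adjP -dotC.
have zN : (msize (u - g) <= N)%N.
  by rewrite (leq_trans (mmeasureD_le _ _ _))// geq_max uN mmeasureN.
have Iz : I (u - g) by exact: subspaceB.
by rewrite -(dnorm_eq0 fock) linearBl /= uE// subrr.
Qed.

Lemma metric_representation g : I g -> exists (r : nat) (f phi : 'I_r -> A),
  [/\ injective phi /\ (forall k, Phi (phi k)),
      g = \sum_(k < r) f k * phi k,
      (forall k, (degree (phi k) + degree (f k) <= degree g)%N) &
      fock g g = \sum_(k < r) fock (f k) (f k)].
Proof.
move=> Ig; have [s sN] := enumerates_exists (msize g).
have [s_on sE] := sN.
have sP (k : 'I_(size s)) : exists2 n, (n < msize g)%N & P n s`_k.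
  by have /sE[n ns Pn] : s`_k \in s by [rewrite mem_nth]; exists n.
exists (size s), (fun k => h s`_k g), (fun k => delta s`_k); split.
- split=> [j k djk|k]; last first.
    by have [n _ Pn] := sP k; exists n => //; exists s`_k.
  have [n _ Pj] := sP j; have [n' _ Pk] := sP k; apply/val_inj/eqP => /=.
  have /orthonormalP[s_uniq _] := s_on.
  rewrite -(nth_uniq 0 (ltn_ord j) (ltn_ord k) s_uniq); apply: contrapT => /negP jk.
  (* If two distinct entries had the same image under [delta], that image would be orthogonal to
     itself. *)
  have := delta_orthogonal Pj Pk jk; rewrite -djk => /eqP.
  by rewrite (dnorm_eq0 fock) (negPf (delta_homog Pj).1).
- by rewrite {1}(mult_adj_expansion sN Ig (leqnn _)) (big_nth 0) big_mkord.
- move=> k; have [n ng Pk] := sP k; have [dk0 dkn] := delta_homog Pk.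
  rewrite /degree (homog_msizeE dk0 dkn) /=.
  (* A zero coefficient has degree 0 by convention, and the bound then reads [n <= degree g]. *)
  have [->|h0] := eqVneq (h s`_k g) 0.
    by rewrite msize0 addn0 -ltnS (ltn_predK ng).
  rewrite -(mlead_deg h0) /= -ltnS (ltn_predK ng) addnC.
  exact: mult_adj_degree dkn (mlead_supp h0).
- by rewrite (coisometry sN)// (big_nth 0) big_mkord.
Qed.

Lemma Phi_choice r (phi : 'I_r -> A) : injective phi ->
  (forall k, Phi (phi k)) -> exists (n : 'I_r -> nat) (psi : 'I_r -> A),
  injective psi /\ forall k, P (n k) (psi k) /\ delta (psi k) = phi k.
Proof.
move=> phi_inj Phi_phi.
have /choice[n nP] k : exists n, exists2 psi, P n psi & delta psi = phi k.
  by have [n _ [psi Ppsi dpsi]] := Phi_phi k; exists n, psi.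
have /choice[psi psiP] k : exists psi, P (n k) psi /\ delta psi = phi k.
  by have [psi Ppsi dpsi] := nP k; exists psi.
exists n, psi; split=> // j k jk; apply: phi_inj.
by rewrite -(psiP j).2 -(psiP k).2 jk.
Qed.

(** Expand the nonnegative sum of the squared norms of [f k - h (psi k) g]. Each cross sum equals
    the squared norm of [g], while the squared norms of the [h (psi k) g] add up to at most that
    much. *)
Lemma metric_contractive r (f phi : 'I_r -> A) : injective phi ->
  (forall k, Phi (phi k)) ->
  fock (\sum_(k < r) f k * phi k) (\sum_(k < r) f k * phi k) <=
    \sum_(k < r) fock (f k) (f k).
Proof.
move=> phi_inj Phi_phi; have [n [psi [psi_inj psiP]]] := Phi_choice phi_inj Phi_phi.
set g := \sum_(k < r) _.
have Ipsi k : I (psi k) by case: (psiP k) => /PI[].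
have Ig : I g.
  apply: subspace_sum => // k _; rewrite -(psiP k).2.
  by case: I_ideal => _ _ IM; apply/IM/deltaI.
(* Large enough for [g] and for every [psi k] to occur in the list. *)
pose N := maxn (msize g) (\max_(k < r) (n k).+1).
have [s sN] := enumerates_exists N.
have gN : (msize g <= N)%N by rewrite leq_maxl.
have psis k : psi k \in s.
  apply/sN.2; exists (n k); last by case: (psiP k).
  by rewrite /= /N leq_max (leq_bigmax k) orbT.
(* Over all of [s] there is equality by [coisometry]; the [psi k] are distinct entries of [s], and
   the remaining terms are nonnegative. *)
have bessel : \sum_(k < r) fock (h (psi k) g) (h (psi k) g) <= fock g g.
  rewrite (coisometry sN Ig Ig gN gN).
  have /orthonormalP[s_uniq _] := sN.1.
  have psi_uniq : uniq [seq psi k | k <- enum 'I_r].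
    by rewrite map_inj_uniq ?enum_uniq.
  rewrite -[leLHS]big_enum /= -(big_map psi xpredT (fun p => fock (h p g) (h p g))).
  set ps := [seq psi k | k <- _] in psi_uniq *.
  rewrite [leRHS](bigID (mem ps)) /= ler_wpDr//.
    by apply: sumr_ge0 => p _; exact: (dnorm_ge0 fock).
  rewrite -[leRHS]big_filter le_eqVlt; apply/orP; left.
  apply/eqP/perm_big/uniq_perm => //.
    exact: filter_uniq.
  move=> p; rewrite mem_filter; case: (boolP (p \in ps)) => //= /mapP[k _ ->].
  by rewrite psis.
have cross : \sum_(k < r) fock (h (psi k) g) (f k) = fock g g.
  rewrite {3}/g dot_sumr; apply: eq_bigr => k _.
  by rewrite mult_adjP (psiP k).2.
have : 0 <= \sum_(k < r) fock (f k - h (psi k) g) (f k - h (psi k) g).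
  by apply: sumr_ge0 => k _; exact: (dnorm_ge0 fock).
have expand p q : fock (p - q) (p - q) =
    fock p p + fock q q - fock p q - fock q p.
  by rewrite linearBl !linearBr /=; ring.
under eq_bigr do rewrite expand.
rewrite !big_split /= !sumrN cross.
have -> : \sum_(k < r) fock (f k) (h (psi k) g) = fock g g.
  rewrite (dotC fock g g) -cross rmorph_sum; apply: eq_bigr => k _.
  exact: dotC.
move=> ge0; rewrite -subr_ge0; apply: le_trans ge0 _.
by rewrite lerD2r -addrA gerDl subr_le0.
Qed.

Lemma Phi_lin_indep : lin_indep Phi.
Proof.
move=> r c u u_inj Phi_u sum0 k.
have [n [psi [psi_inj psiP]]] := Phi_choice u_inj Phi_u.
have /(congr1 (fock ^~ (u k))) := sum0; rewrite linear0l dot_suml (bigD1 k)//=.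
rewrite big1 ?addr0 => [|j jk].
  rewrite dotZl => /eqP; rewrite mulf_eq0 (dnorm_eq0 fock) -(psiP k).2.
  by rewrite (negPf (delta_homog (psiP k).1).1) orbF => /eqP.
rewrite dotZl -(psiP j).2 -(psiP k).2.
rewrite (delta_orthogonal (psiP j).1 (psiP k).1) ?mulr0//.
by apply: contra jk => /eqP/psi_inj->.
Qed.

Lemma defect_metric_basis : is_metric_basis I Phi.
Proof.
split; [split| |].
- by move=> _ [n _ [p Pp <-]]; case: (PI Pp) => Ip _; exact: deltaI.
- by move=> _ [n _ [p Pp <-]]; apply: (homogE (delta_homog Pp).2).
- exact: Phi_lin_indep.
- move=> g /metric_representation[r [f [phi [[_ Phi_phi] gE _ _]]]].
  by exists r, f, phi.
- exact: metric_contractive.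
- exact: metric_representation.
Qed.

End MetricBasis.

(** * The defect operator on the closure of a graded ideal *)

Section Closure.
Variables (K : numFieldType) (V : normedModType K).
Implicit Types (S : set V).

Lemma closure_approx S (x : V) (e : K) : closure S x -> 0 < e ->
  exists2 y, S y & `|x - y| < e.
Proof.
move=> Sx e0; have [y [Sy xy]] := Sx _ (nbhsx_ballx x e e0).
by exists y => //; move: xy; rewrite -ball_normE.
Qed.

Lemma closure_subspace S : is_subspace S -> is_subspace (closure S).
Proof.
move=> S_sub; split; first by apply: subset_closure; case: S_sub.
move=> a x y Sx Sy B /nbhs_ballP[e /= e0 eB].
(* Adding 1 keeps the divisor nonzero when [a] is 0. *)
have a0 : 0 < `|a| + 1 by rewrite ltr_wpDl.
have e20 : 0 < e / 2 by rewrite divr_gt0.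
have [x' Sx' xx'] := closure_approx Sx (divr_gt0 e20 a0).
have [y' Sy' yy'] := closure_approx Sy e20.
exists (a *: x' + y'); split; first exact: S_sub.2.
apply: eB; rewrite -ball_normE /= opprD addrACA -scalerBr.
apply: le_lt_trans (ler_normD _ _) _; rewrite [ltRHS]splitr.
apply: ler_ltD yy'; rewrite normrZ.
have := ltW xx'; rewrite ler_pdivlMr// mulrC; apply: le_trans.
by rewrite ler_wpM2r// lerDl.
Qed.

End Closure.

Section Hilbert.
Variables (R : realType) (H : normedModType R[i]).
Variable dot : {dot H for (@Num.conj R[i])}.
Hypothesis dot_norm : forall x : H, `|x| ^+ 2 = dot x x.

(** If [x] were nonzero, some [y] in [S] would be closer to [x] than 0 is, against Pythagoras. *)
Lemma closure_orthogonal0 (S : set H) x :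
  closure S x -> (forall y, S y -> dot x y = 0) -> x = 0.
Proof.
move=> Sx x_orth; apply/eqP; rewrite -normr_eq0; apply: contrapT => /negP x0.
have x_gt0 : 0 < `|x| by rewrite lt_def x0 normr_ge0.
have [y Sy] := closure_approx Sx x_gt0.
rewrite -(@ltr_pXn2r _ 2)// ?nnegrE// !dot_norm (hnormBd (x_orth _ Sy)).
by rewrite gtrDl le_gtF ?(dnorm_ge0 dot).
Qed.

End Hilbert.

Section GradedIdeal.
Variables (R : realType) (d : nat).
Local Notation C := R[i].
Local Notation A := {mpoly C[d]}.
Variable I : set A.
Hypothesis hI : is_graded_ideal I.

(** The projection fixes or kills each homogeneous element of [I], and these span [I]. *)
Lemma graded_pihomog n p : I p -> I (pihomog mdeg n p).
Proof.
have [I_ideal I_span] := hI; have I_sub := ideal_subspace I_ideal.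
move=> /I_span[r [c [u [Iu ->]]]]; rewrite linear_sum.
apply: subspace_sum => // k _; rewrite linearZ; apply: subspaceZ => //.
have [Iuk /homogP[j uj]] := Iu k; have [<-|jn] := eqVneq j n.
  by rewrite /= pihomog_dE.
by rewrite /= (pihomog_ne0 jn uj); case: I_sub.
Qed.

End GradedIdeal.

(** * The homogeneous parts of [M] and the operators on them *)

Section Operators.
Variables (R : realType) (d : nat).
Local Notation C := R[i].
Local Notation A := {mpoly C[d]}.
Local Notation fock := (@fock R d).
Variables (H : completeNormedModType C) (dot : {dot H for (@Num.conj C)}).
Variable iota : {linear A -> H}.
Hypothesis hH : is_fock_space dot iota.
Variable Z : 'I_d -> {linear H -> H}.
Hypothesis hZ : forall k, is_multiplication iota k (Z k).
Variable I : set A.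
Hypothesis hI : is_graded_ideal I.
Local Notation M := (closure (iota @` I)).
Variable Tadj : 'I_d -> H -> H.
Hypothesis hTadj : forall k, is_adjoint_on dot M (Z k) (Tadj k).
Variable Delta : H -> H.
Hypothesis hDelta : is_defect_operator dot M (fun k => Z k) Tadj Delta.

Lemma dot_iota p q : dot (iota p) (iota q) = fock p q.
Proof. by case: hH => _ -> _. Qed.

Lemma iota_inj : injective iota.
Proof.
move=> p q pq; apply/eqP; rewrite -subr_eq0 -(dnorm_eq0 fock) -dot_iota.
by rewrite linearB /= pq subrr linear0l.
Qed.

Lemma Z_iota k p : Z k (iota p) = iota ('X_k * p).
Proof. by case: (hZ k). Qed.

Let I_sub : is_subspace I := ideal_subspace hI.1.

Lemma image_subspace (S : set A) : is_subspace S -> is_subspace (iota @` S).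
Proof.
move=> [S0 S_lin]; split; first by exists 0; rewrite ?linear0.
move=> a _ _ [p Sp <-] [q Sq <-]; exists (a *: p + q); last exact: linearP.
exact: S_lin.
Qed.

Let M_sub : is_subspace M := closure_subspace (image_subspace I_sub).

Lemma M_iota p : I p -> M (iota p).
Proof. by move=> Ip; apply: subset_closure; exists p. Qed.

Lemma Delta_M x : M x -> M (Delta x).
Proof. by case: hDelta => -[+ _ _] _ _; apply. Qed.

Lemma Delta_lin a x y : M x -> M y ->
  Delta (a *: x + y) = a *: Delta x + Delta y.
Proof. by case: hDelta => -[_ + _] _ _; apply. Qed.

Lemma Delta_sym x y : M x -> M y -> dot (Delta x) y = dot x (Delta y).
Proof.
apply: (positive_symmetric M_sub); first exact: Delta_lin.
by case: hDelta.
Qed.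

Lemma Delta_sq x : M x -> Delta (Delta x) = x - \sum_(k < d) Z k (Tadj k x).
Proof. by case: hDelta => _ _; apply. Qed.

Lemma Tadj_M k x : M x -> M (Tadj k x).
Proof. by case: (hTadj k) => -[+ _ _] _; apply. Qed.

Lemma Tadj_lin k a x y : M x -> M y ->
  Tadj k (a *: x + y) = a *: Tadj k x + Tadj k y.
Proof. by case: (hTadj k) => -[_ + _] _; apply. Qed.

Lemma Tadj_dot k x y : M x -> M y -> dot (Tadj k x) y = dot x (Z k y).
Proof.
by move=> Mx My; case: (hTadj k) => _ adj; rewrite dotC -adj// -dotC.
Qed.

(** The degree [n] part of [M], taken in [I] before closing so that its elements come with a
    polynomial of the ideal; [hpart_exhaustive] shows that nothing is lost. *)
Definition hpart n : set H := iota @` [set p | I p /\ p \is n.-homog].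

Lemma hpart_subspace n : is_subspace (hpart n).
Proof.
apply: image_subspace; split=> [|a p q [Ip pn] [Iq qn]].
  by split; [case: I_sub | exact: dhomog0].
by split; [exact: I_sub.2 | apply: dhomogD => //; exact: dhomogZ].
Qed.

Lemma hpart_M n : hpart n `<=` M.
Proof. by move=> _ [p [Ip _] <-]; exact: M_iota. Qed.

Lemma hpart_basis n : exists2 s, orthonormal dot s /\
    (forall u, u \in s -> hpart n u) &
    forall x, hpart n x -> x = \sum_(u <- s) dot x u *: u.
Proof.
apply: (orthonormal_basis_exists dot
  (e := fun m : 'X_{1..d < n.+1} => iota 'X_[m])); first exact: hpart_subspace.
move=> _ [p [_ pn] <-]; exists (fun m : 'X_{1..d < n.+1} => p@_m).
rewrite {1}(@mpolywE _ _ n.+1 p) ?linear_sum /=.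
  by apply: eq_bigr => m _; rewrite linearZ.
have [->|p0] := eqVneq p 0; first by rewrite msize0.
by rewrite (homog_msizeE p0 pn).
Qed.

(** Polynomials in [I] split into homogeneous parts in [I], so [x - y] is orthogonal to a set whose
    closure contains it. *)
Lemma M_eq x y : M x -> M y ->
  (forall n z, hpart n z -> dot x z = dot y z) -> x = y.
Proof.
move=> Mx My xy; apply/eqP; rewrite -subr_eq0; apply/eqP.
apply: (@closure_orthogonal0 _ _ dot _ (iota @` I)).
- by case: hH.
- exact: (subspaceB M_sub).
move=> _ [p Ip <-]; rewrite linearBl /= (pihomog_partitionE (leqnn (msize p))).
rewrite linear_sum !dot_sumr -sumrB big1// => j _; apply/eqP.
rewrite subr_eq0; apply/eqP/(xy j); exists (pihomog mdeg j p) => //.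
by split; [exact: graded_pihomog | exact: pihomogP].
Qed.

Lemma hpart_orth j k x y : j != k -> hpart j x -> hpart k y -> dot x y = 0.
Proof.
move=> jk [p [_ pj] <-] [q [_ qk] <-]; rewrite dot_iota.
exact: fock_homog_orth jk pj qk.
Qed.

(* [M] is the orthogonal sum of its finite-dimensional homogeneous parts. *)
Lemma hpartP n v : M v ->
  (forall k y, k != n -> hpart k y -> dot v y = 0) -> hpart n v.
Proof.
move=> Mv v_orth; have [s [s_on sW] s_exp] := hpart_basis n.
(* The orthogonal projection of [v] onto [hpart n]. *)
pose u := \sum_(w <- s) dot v w *: w.
have Wu : hpart n u.
  rewrite /u big_seq; apply: subspace_sum (hpart_subspace n) _ _ _ _ _ => w /sW.
  exact: subspaceZ (hpart_subspace n) _ _.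
suff -> : v = u by [].
apply: M_eq => //; first exact: hpart_M Wu.
move=> k z Wz; have [kn|kn] := eqVneq k n; last first.
  by rewrite (v_orth _ _ kn Wz) (hpart_orth _ Wu Wz)// eq_sym.
rewrite kn in Wz; rewrite (s_exp _ Wz) !dot_sumr !big_seq.
apply: eq_bigr => w ws; rewrite !dotZr; congr (_ * _).
by rewrite (orthonormal_coord _ s_on).
Qed.

Lemma Z_hpart n k x : hpart n x -> hpart n.+1 (Z k x).
Proof.
move=> [p [Ip pn] <-]; exists ('X_k * p); last by rewrite Z_iota.
split; first by case: hI => -[_ _ IM] _; exact: IM.
by rewrite -add1n; apply: dhomogM => //; rewrite dhomogX /= mdeg1.
Qed.

(** [Z k] raises the degree by one, so its range on [M] is orthogonal to constants; in positive
    degree the adjoint lowers the degree by one. *)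
Lemma Tadj_hpart0 k x : hpart 0 x -> Tadj k x = 0.
Proof.
move=> W0x; have Mx := hpart_M W0x.
apply: M_eq; [exact: Tadj_M | by case: M_sub | move=> n z Wz].
rewrite linear0l Tadj_dot//; last exact: hpart_M Wz.
by apply: (hpart_orth _ W0x (Z_hpart k Wz)).
Qed.

Lemma Tadj_hpartS n k x : hpart n.+1 x -> hpart n (Tadj k x).
Proof.
move=> Wx; have Mx := hpart_M Wx; apply: hpartP; first exact: Tadj_M.
move=> j y jn Wy; rewrite Tadj_dot//; last exact: hpart_M Wy.
by apply: (hpart_orth _ Wx (Z_hpart k Wy)); rewrite eqSS eq_sym.
Qed.

(** [Tadj k] lowers the degree and [Z k] restores it, so the square of [Delta] preserves degrees;
    [positive_sqrt_invariant] passes this to [Delta]. *)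
Lemma Delta_hpart n x : hpart n x -> hpart n (Delta x).
Proof.
have [s [s_on sW] s_exp] := hpart_basis n.
have Delta_ge0 y : M y -> 0 <= dot (Delta y) y by case: hDelta => _ + _; apply.
apply: (positive_sqrt_invariant M_sub Delta_M Delta_lin Delta_ge0 _ _ s_on) => //.
- exact: hpart_M.
- exact: hpart_subspace.
move=> {}x Wx; rewrite Delta_sq; last exact: hpart_M Wx.
apply: subspaceB => //; first exact: hpart_subspace.
apply: subspace_sum; first exact: hpart_subspace.
move=> k _; case: n Wx {s s_on sW s_exp} => [|n] Wx.
  rewrite Tadj_hpart0// linear0; by case: (hpart_subspace 0).
exact/Z_hpart/Tadj_hpartS.
Qed.

(** Orthogonality of distinct degrees makes [hpartP] applicable. This places the homogeneous
    polynomials of [G], defined through closures, in the ideal itself. *)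
Lemma hpart_exhaustive n p : M (iota p) -> p \is n.-homog -> hpart n (iota p).
Proof.
move=> Mp pn; apply: hpartP => // k _ kn [q [_ qk] <-].
by rewrite dot_iota (fock_homog_orth _ pn qk)// eq_sym.
Qed.

Lemma iota_pihomog p :
  iota p = \sum_(j < msize p) iota (pihomog mdeg j p).
Proof. by rewrite {1}(pihomog_partitionE (leqnn (msize p))) linear_sum. Qed.

Lemma hpart_pihomog p n : I p -> hpart n (iota (pihomog mdeg n p)).
Proof.
move=> Ip; exists (pihomog mdeg n p) => //.
by split; [exact: graded_pihomog | exact: pihomogP].
Qed.

Lemma Tadj_poly k p : I p -> exists q,
  [/\ I q, (msize q <= (msize p).-1)%N & Tadj k (iota p) = iota q].
Proof.
move=> Ip; suff : (iota @` [set q | I q /\ (msize q <= (msize p).-1)%N])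
    (Tadj k (iota p)) by move=> [q [Iq qp] <-]; exists q.
have F_sub : is_subspace (iota @` [set q | I q /\ (msize q <= (msize p).-1)%N]).
  apply: image_subspace; split=> [|a q q' [Iq qp] [Iq' q'p]].
    by split; [case: I_sub | rewrite msize0].
  split; first exact: I_sub.2.
  rewrite (leq_trans (mmeasureD_le _ _ _))// geq_max q'p andbT.
  exact: leq_trans (msizeZ_le _ _) qp.
rewrite iota_pihomog (lin_on_sum M_sub (@Tadj_lin k)); last first.
  by move=> j _; apply: M_iota; exact: graded_pihomog.
apply: (subspace_sum F_sub) => -[[|j] /= jp] _.
  by rewrite Tadj_hpart0; [exact: F_sub.1 | exact: hpart_pihomog].
have [q [Iq qj] <-] := Tadj_hpartS k (hpart_pihomog j.+1 Ip).
exists q => //; split=> //; have [->|q0] := eqVneq q 0; first by rewrite msize0.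
(* Here [q] has size [j.+1], and [j.+1 < msize p]. *)
by rewrite (homog_msizeE q0 qj) -ltnS (ltn_predK jp).
Qed.

Lemma Delta_iota p : I p ->
  Delta (iota p) = \sum_(j < msize p) Delta (iota (pihomog mdeg j p)).
Proof.
move=> Ip; rewrite {1}iota_pihomog (lin_on_sum M_sub Delta_lin)// => j _.
by apply: M_iota; exact: graded_pihomog.
Qed.

Lemma Delta_poly p : I p -> exists q, I q /\ Delta (iota p) = iota q.
Proof.
move=> Ip; suff : (iota @` I) (Delta (iota p)) by move=> [q Iq <-]; exists q.
rewrite Delta_iota//; apply: subspace_sum (image_subspace I_sub) _ _ _ _ _ => j _.
have [q [Iq _] <-] := Delta_hpart (hpart_pihomog j Ip).
by exists q.
Qed.

Local Notation G := (closure (Delta @` M)).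

Lemma G_M : G `<=` M.
Proof.
move=> x Gx; rewrite (closure_id M).1; last exact: closed_closure.
apply: closure_subset Gx => _ [y My <-]; exact: Delta_M.
Qed.

Lemma homog_part_hpart n : homog_part iota G n `<=` hpart n.
Proof.
by move=> x [/G_M + [p pn px]]; rewrite -px => Mp; exact: hpart_exhaustive.
Qed.

(** Serves both the invariance of the homogeneous parts of [G] under [Delta] and the expansion of
    [Delta x] in the basis [Psi n]. *)
Lemma Delta_homog_part n x : hpart n x -> homog_part iota G n (Delta x).
Proof.
move=> Wx; split; first by apply: subset_closure; exists x => //; exact: hpart_M Wx.
by have [p [_ pn] px] := Delta_hpart Wx; exists p.
Qed.

(** By symmetry the kernel of [Delta] is orthogonal to its range. Consequently the eigenvalues
    belonging to the [Psi n] are nonzero, and so are the elements of [Phi]. *)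
Lemma Delta_G_inj x : G x -> Delta x = 0 -> x = 0.
Proof.
move=> Gx Dx; apply: (@closure_orthogonal0 _ _ dot _ _ _ Gx); first by case: hH.
by move=> _ [y My <-]; rewrite -Delta_sym ?Dx ?linear0l//; exact: G_M.
Qed.

Lemma dot_defect x y : M x -> M y -> dot x y =
  \sum_(k < d) dot (Tadj k x) (Tadj k y) + dot (Delta x) (Delta y).
Proof.
move=> Mx My; rewrite -Delta_sym//; last exact: Delta_M.
rewrite Delta_sq// linearBl /= dot_suml.
have -> : \sum_(k < d) dot (Z k (Tadj k x)) y =
    \sum_(k < d) dot (Tadj k x) (Tadj k y).
  apply: eq_bigr => k _.
  by rewrite [LHS]dotC -Tadj_dot//; [rewrite -dotC | exact: Tadj_M].
by rewrite addrC subrK.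
Qed.

(** [Tadj k] and [Delta] preserve the image of [I], so they can be read as maps [t k] and [delta] on
    polynomials, to which [defect_metric_basis] applies. *)
Lemma defect_operator_metric_basis (Psi : nat -> set H) :
  (forall n, is_orthonormal_basis dot (homog_part iota G n) (Psi n)) ->
  (forall n psi, Psi n psi -> is_eigenvector Delta psi) ->
  is_metric_basis I (iota @^-1` (\bigcup_n (Delta @` Psi n))).
Proof.
move=> Psi_basis Psi_eigen.
have /choice[t tP] (k : 'I_d) : exists t : A -> A, forall p, I p ->
    [/\ I (t p), (msize (t p) <= (msize p).-1)%N & Tadj k (iota p) = iota (t p)].
  suff /choice[t tP] : forall p, exists q, I p ->
      [/\ I q, (msize q <= (msize p).-1)%N & Tadj k (iota p) = iota q] by exists t.
  (* Outside [I] the value is arbitrary. *)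
  move=> p; have [Ip|nIp] := pselect (I p); last by exists 0.
  by have [q qP] := Tadj_poly k Ip; exists q.
have /choice[delta deltaP] p : exists q, I p -> I q /\ Delta (iota p) = iota q.
  have [Ip|nIp] := pselect (I p); last by exists 0.
  by have [q qP] := Delta_poly Ip; exists q.
pose P n := iota @^-1` Psi n.
have Psi_hpart n x : Psi n x -> hpart n x.
  by move=> Px; have [sub _ _] := Psi_basis n; exact/homog_part_hpart/sub.
have PI n p : P n p -> I p /\ p \is n.-homog.
  by move=> /Psi_hpart[q + /iota_inj <-].
have -> : iota @^-1` (\bigcup_n (Delta @` Psi n)) = \bigcup_n (delta @` P n).
  apply/seteqP; split=> [p [n _ [x Px xp]]|_ [n _ [p Pp <-]]].
    have [q [Iq _] qx] := Psi_hpart _ _ Px; exists n => //; exists q.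
      by rewrite /P /= qx.
    by apply: iota_inj; rewrite -(deltaP _ Iq).2 qx.
  exists n => //; exists (iota p) => //.
  by rewrite (deltaP _ (PI _ _ Pp).1).2.
have Idelta x : I x -> I (delta x) by move=> /deltaP[].
apply: (@defect_metric_basis _ _ I t delta P) => //.
- by case: hI.
- by move=> k x /(tP k)[].
- by move=> k x /(tP k)[].
- move=> k x y Ix Iy; have [_ _ tx] := tP k x Ix.
  by rewrite -!dot_iota -tx Tadj_dot ?Z_iota//; exact: M_iota.
- move=> x y Ix Iy; have [_ dx] := deltaP _ Ix; have [_ dy] := deltaP _ Iy.
  by rewrite -!dot_iota -dx -dy Delta_sym//; exact: M_iota.
- move=> x y Ix Iy; have [_ dx] := deltaP _ Ix; have [_ dy] := deltaP _ Iy.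
  rewrite -!dot_iota -dx -dy (dot_defect (M_iota Ix) (M_iota Iy)); congr (_ + _).
  apply: eq_bigr => k _; have [_ _ tx] := tP k x Ix; have [_ _ ty] := tP k y Iy.
  by rewrite -dot_iota -tx -ty.
- move=> n p q Pp Pq; have [_ on _] := Psi_basis n.
  by rewrite -dot_iota on// (inj_eq iota_inj).
- move=> n p Pp; have [p0 [a pa]] := Psi_eigen n _ Pp.
  have [_ dp] := deltaP _ (PI _ _ Pp).1.
  exists a; last by apply: iota_inj; rewrite -dp pa linearZ.
  apply: contra_neq p0 => a0; apply: Delta_G_inj; last by rewrite pa a0 scale0r.
  by have [sub _ _] := Psi_basis n; case: (sub _ Pp).
move=> x Ix.
(* For the span hypothesis [x] is split by degree: [Delta] sends the part of degree [j] into the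
   degree [j] part of [G], which [Psi j] spans, and only [j < msize x] occur. *)
have dx : delta x = \sum_(j < msize x) delta (pihomog mdeg j x).
  apply: iota_inj; rewrite -(deltaP _ Ix).2 (Delta_iota Ix) linear_sum /=.
  by apply: eq_bigr => j _; rewrite (deltaP _ (graded_pihomog hI j Ix)).2.
rewrite dx; apply: lin_span_sum => j _.
have Ixj := graded_pihomog hI j Ix.
suff : lin_span (P j) (delta (pihomog mdeg j x)).
  by apply: lin_span_sub => p Pp; exists (val j) => //=.
have [_ _ span] := Psi_basis j.
have [r [c [u [Pu uE]]]] := span _ (Delta_homog_part (hpart_pihomog j Ix)).
have /choice[p pE] k : exists p, iota p = u k.
  by have [p _ pu] := Psi_hpart _ _ (Pu k); exists p.
exists r, c, p; split=> [k|]; first by rewrite /P /= pE.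
apply: iota_inj; rewrite -(deltaP _ Ixj).2 uE linear_sum.
by apply: eq_bigr => k _; rewrite linearZ /= pE.
Qed.

End Operators.

Theorem proposition8p7
  (R : realType) (d : nat) (hd : (1 <= d)%N)
  (* H^2(C^d) *)
  (H : completeNormedModType R[i]) (dot : {dot H for (@Num.conj R[i])})
  (iota : {linear {mpoly R[i][d]} -> H})
  (hH : is_fock_space dot iota)
  (Z : 'I_d -> {linear H -> H})
  (hZ : forall k, is_multiplication iota k (Z k))
  (I : set {mpoly R[i][d]})
  (hI : is_graded_ideal I)
  (hI0 : exists2 p, I p & p != 0)
  (M : set H) (hM : M = closure (iota @` I))
  (Tadj : 'I_d -> H -> H)
  (hTadj : forall k, is_adjoint_on dot M (Z k) (Tadj k))
  (Delta : H -> H)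
  (hDelta : is_defect_operator dot M (fun k => Z k) Tadj Delta)
  (G : set H) (hG : G = closure (Delta @` M)) :
  (forall n, Delta @` homog_part iota G n `<=` homog_part iota G n) /\
  forall Psi : nat -> set H,
    (forall n, is_orthonormal_basis dot (homog_part iota G n) (Psi n)) ->
    (forall n psi, Psi n psi -> is_eigenvector Delta psi) ->
    is_metric_basis I (iota @^-1` (\bigcup_n (Delta @` Psi n))).
Proof.
subst M G; split; last exact: (defect_operator_metric_basis hH hZ hI hTadj hDelta).
move=> n _ [x Gx <-].
apply: (Delta_homog_part hH hZ hI hTadj hDelta).
exact: (homog_part_hpart hH hI hDelta).
Qed.
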